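(* Let $Y_1,Y_2,Y$ be Banach spaces, let $\mathcal C_1$ be a family of subsets of $Y_1$ and $\mathcal C_2$ a family of subsets of $Y_2$, and suppose that a continuous linear surjection $L:Y_1\times Y_2\to Y$ is $(\mathcal C_1\times\mathcal C_2)$-hereditary invertible. Let $A\in\mathcal C_1$ and $B\in\mathcal C_2$. Then the splitting problem for the triple $(F_1(\cdot)\equiv A,\ F_2(\cdot)\equiv B,\ L)$ is solvable for an arbitrary domain $X$; that is, for every topological space $X$ and every continuous single-valued selection $f$ of the constant multivalued mapping $L(F_1;F_2)(\cdot)\equiv L(A,B)$ on $X$ (i.e. every continuous map $f:X\to L(A,B)$), there exist continuous maps $f_1:X\to A$ and $f_2:X\to B$ such that $f(x)=L(f_1(x),f_2(x))$ for all $x\in X$.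
   Context: Banach spaces are over $\mathbb R$. $L(A,B)=\{L(a,b): a\in A,\ b\in B\}$. The family $\mathcal C_1\times\mathcal C_2$ consists of all products $A\times B\subset Y_1\times Y_2$ with $A\in\mathcal C_1$, $B\in\mathcal C_2$. For a family $\mathcal C$ of subsets of a Banach space $Z$, a continuous linear mapping $L:Z\to Y$ between Banach spaces is $\mathcal C$-hereditary invertible if for every $C\in\mathcal C$ the restriction $L|_C:C\to L(C)$ admits a continuous right inverse, i.e. a continuous map $s:L(C)\to C$ with $L|_C\circ s=\mathrm{id}_{L(C)}$. For multivalued mappings $F_i:X\to Y_i$, the composite mapping is $L(F_1;F_2)(x)=\{L(y_1,y_2): y_1\in F_1(x), y_2\in F_2(x)\}$; a selection of a multivalued mapping $F$ is a single-valued map $f$ with $f(x)\in F(x)$ for all $x$; solving the splitting problem means writing each continuous selection $f$ of $L(F_1;F_2)$ as $f=L(f_1;f_2)$ with $f_i$ a continuous selection of $F_i$, $i=1,2$. *)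

(* Defs.v *)
From HB Require Import structures.
From mathcomp Require Import all_boot all_order all_algebra.
From mathcomp Require Import all_classical all_reals all_analysis.

Set Implicit Arguments.
Unset Strict Implicit.
Unset Printing Implicit Defensive.

Import Order.TTheory GRing.Theory Num.Theory.
Import numFieldNormedType.Exports.

Local Open Scope classical_set_scope.
Local Open Scope ring_scope.

Definition family_prod (T1 T2 : Type) (C1 : set (set T1)) (C2 : set (set T2)) :
    set (set (T1 * T2)) :=
  [set A `*` B | A in C1 & B in C2].

(* A map L(C) -> C is represented by a total function s : Y -> Z of which only
   the restriction to L @` C matters: {within L @` C, continuous s} is
   continuity for the topology induced by Y on L @` C.
   Z is not required to be complete, because the library does not declare the
   product of two complete normed modules as complete. *)
Definition hereditary_invertible (R : realType) (Z Y : normedModType R)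
    (C : set (set Z)) (L : {linear Z -> Y}) : Prop :=
  forall D : set Z, C D ->
    exists s : Y -> Z,
      [/\ {within L @` D, continuous s},
          forall y, (L @` D) y -> D (s y)
        & forall y, (L @` D) y -> L (s y) = y].

Definition composite_mapping (X Y1 Y2 Y : Type) (L : Y1 * Y2 -> Y)
    (F1 : X -> set Y1) (F2 : X -> set Y2) : X -> set Y :=
  fun x => [set L (y1, y2) | y1 in F1 x & y2 in F2 x].

Definition continuous_selection (X Y : topologicalType) (F : X -> set Y)
    (f : X -> Y) : Prop :=
  continuous f /\ forall x, F x (f x).

Definition splitting_solvable (X Y1 Y2 Y : topologicalType)
    (F1 : X -> set Y1) (F2 : X -> set Y2) (L : Y1 * Y2 -> Y) : Prop :=
  forall f : X -> Y, continuous_selection (composite_mapping L F1 F2) f ->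
    exists f1 : X -> Y1, exists f2 : X -> Y2,
      [/\ continuous_selection F1 f1,
          continuous_selection F2 f2
        & forall x, f x = L (f1 x, f2 x)].

(* Main.v *)
Require Import Defs.
From mathcomp Require Import all_boot all_order all_algebra.
From mathcomp Require Import all_classical all_reals all_analysis.

Set Implicit Arguments.
Unset Strict Implicit.
Unset Printing Implicit Defensive.

Import Order.TTheory GRing.Theory Num.Theory.
Import numFieldNormedType.Exports.

Local Open Scope classical_set_scope.
Local Open Scope ring_scope.

(** The inverse [s] that hereditary invertibility provides for [A `*` B]
    chooses preimages as a function of the point of [L @` (A `*` B)] alone.
    Hence, for a selection [f] of the composite mapping, [s \o f] is a lift of
    [f] to the product set, and its two coordinates are the required
    selections. Although [s] is continuous only on that image, the lift is
    continuous on the whole domain of [f], because [f] takes its values in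
    the image ([continuous_comp_within]). *)

(** As [f] stays in [S], the image under [f] of the neighbourhood filter of [x]
    converges to [f x] within [S], and not just in [Y]; so only the continuity
    of [g] relative to [S] is at stake. *)
Lemma continuous_comp_within (X Y Z : topologicalType) (S : set Y)
    (f : X -> Y) (g : Y -> Z) :
  continuous f -> (forall x, S (f x)) -> {within S, continuous g} ->
  continuous (g \o f).
Proof.
move=> f_cont fS /subspace_continuousP g_cont x.
apply: cvg_comp (g_cont _ (fS x)) => U.
by rewrite /within /= => /f_cont; apply: (@filterS _ (nbhs x)) => z /(_ (fS z)).
Qed.

Theorem theorem3p1 (R : realType) (Y1 Y2 Y : completeNormedModType R)
    (C1 : set (set Y1)) (C2 : set (set Y2))
    (L : {linear (Y1 * Y2)%type -> Y})
    (L_continuous : continuous L)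
    (L_surjective : set_surj setT setT L)
    (L_invertible : hereditary_invertible (family_prod C1 C2) L)
    (A : set Y1) (B : set Y2) (hA : C1 A) (hB : C2 B)
    (X : topologicalType) :
  splitting_solvable (fun _ : X => A) (fun _ : X => B) L.
Proof.
move=> f [f_cont f_sel].
have [|s [s_cont s_in sK]] := L_invertible (A `*` B).
  by exists A => //; exists B.
have f_im x : (L @` (A `*` B)) (f x).
  by have [a Aa [b Bb <-]] := f_sel x; exists (a, b).
have sf_cont : continuous (s \o f) by exact: continuous_comp_within s_cont.
exists (fst \o (s \o f)), (snd \o (s \o f)); split.
- split=> [x|x]; last by have [] := s_in _ (f_im x).
  by apply: continuous_comp; [exact: sf_cont | exact: cvg_fst].
- split=> [x|x]; last by have [] := s_in _ (f_im x).
  by apply: continuous_comp; [exact: sf_cont | exact: cvg_snd].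
- by move=> x /=; rewrite -surjective_pairing sK.
Qed.
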